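(* The property of being condensed is not geometric, i.e. it is not stable under quasi-isometry of finitely generated groups: there exist quasi-isometric finitely generated groups $G$ and $H$ such that $G$ is condensed and $H$ is not condensed.
   Context: The space of finitely generated marked groups. An $n$-generated marked group is a pair $(G,(a_1,\dots,a_n))$ where $G$ is a group generated by $a_1,\dots,a_n$; two such pairs $(G,(a_i))$, $(H,(b_i))$ are identified if $a_i\mapsto b_i$ extends to an isomorphism $G\to H$. Let $\mathcal G_n$ be the set of all $n$-generated marked groups. With $F_n$ free on $x_1,\dots,x_n$, the map sending $(G,(a_i))$ to the kernel of the epimorphism $F_n\to G$, $x_i\mapsto a_i$, is a bijection from $\mathcal G_n$ to the set of normal subgroups of $F_n$; the latter has the subspace topology from $2^{F_n}$ (product topology), and $\mathcal G_n$ has the pulled-back topology. The map $(G,(a_1,\dots,a_n))\mapsto(G,(a_1,\dots,a_n,1))$ is a continuous embedding $\mathcal G_n\to\mathcal G_{n+1}$, and $\mathcal G=\bigcup_n\mathcal G_n$ with the topological union topology. For a finitely generated group $G$, put $[G]=\{(H,B)\in\mathcal G\mid H\cong G\}$. $G$ is condensed if $[G]$ (with the subspace topology) has no isolated points. Quasi-isometry of finitely generated groups is with respect to word metrics of finite generating sets. *)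

(* Defs.v *)
From HB Require Import structures.
From mathcomp Require Import all_boot all_order all_algebra.
From mathcomp Require Import all_classical all_reals topology.

Set Implicit Arguments.
Unset Strict Implicit.
Unset Printing Implicit Defensive.

Local Open Scope classical_set_scope.
Local Open Scope group_scope.

(* A letter (x, false) stands for x and (x, true) for x^-1. *)
Notation word X := (seq (X * bool)).

Section FreeGroup.
Variable X : choiceType.
Implicit Types (l : X * bool) (w : word X).

Definition opp_letter l : X * bool := (l.1, ~~ l.2).

Fixpoint reduced w : bool :=
  if w is l :: w' then
    (if w' is l' :: _ then l' != opp_letter l else true) && reduced w'
  else true.

Definition push l w : word X :=
  if w is l' :: w' then if l' == opp_letter l then w' else l :: w
  else [:: l].

(* The reduced form of u ++ v, for v reduced. *)
Definition push_word u v : word X := foldr push v u.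

Definition inv_word w : word X := rev (map opp_letter w).

Lemma opp_letterK : involutive opp_letter.
Proof. by case=> x b; rewrite /opp_letter /= negbK. Qed.

Lemma reduced_behead l w : reduced (l :: w) -> reduced w.
Proof. by move=> /= /andP[]. Qed.

Lemma push_reduced l w : reduced w -> reduced (push l w).
Proof.
case: w => //= l' w' rw; case: eqP => [_|/eqP nl]; first by case/andP: rw.
by rewrite /= nl.
Qed.

Lemma push_word_reduced u v : reduced v -> reduced (push_word u v).
Proof. by move=> rv; elim: u => //= l u; exact: push_reduced. Qed.

Lemma push_cons l w : reduced (l :: w) -> push l w = l :: w.
Proof. by case: w => //= l' w /andP[/negPf->]. Qed.

Lemma push_oppK l w : reduced w -> push l (push (opp_letter l) w) = w.
Proof.
case: w => [|l' w] /=; first by rewrite eqxx.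
rewrite opp_letterK; case: eqP => [->|_] rw; last by rewrite /= eqxx.
exact: push_cons.
Qed.

Lemma push_word_push l u v :
  reduced v -> push_word (push l u) v = push l (push_word u v).
Proof.
case: u => //= l' u rv; case: eqP => // ->.
by rewrite push_oppK //; exact: push_word_reduced.
Qed.

Lemma push_wordA u v w : reduced w ->
  push_word u (push_word v w) = push_word (push_word u v) w.
Proof. by move=> rw; elim: u => //= l u ->; rewrite push_word_push. Qed.

Lemma push_word_nil w : reduced w -> push_word w [::] = w.
Proof.
elim: w => //= l w IH rlw.
by rewrite IH ?push_cons //; exact: reduced_behead rlw.
Qed.

Lemma push_word_cat u v w : push_word (u ++ v) w = push_word u (push_word v w).
Proof. exact: foldr_cat. Qed.

Lemma inv_word_cons l w : inv_word (l :: w) = inv_word w ++ [:: opp_letter l].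
Proof. by rewrite /inv_word /= rev_cons -cats1. Qed.

Lemma inv_wordK : involutive inv_word.
Proof.
by move=> w; rewrite /inv_word map_rev revK -map_comp map_id_in // => l _;
  exact: opp_letterK.
Qed.

Lemma push_word_inv w v : reduced v -> push_word w (push_word (inv_word w) v) = v.
Proof.
elim: w v => //= l w IH v rv.
by rewrite inv_word_cons push_word_cat IH ?push_oppK //; exact: push_reduced.
Qed.

Record free_group := FreeGroup { fg_word :> word X; _ : reduced fg_word }.

HB.instance Definition _ := [isSub for fg_word].
HB.instance Definition _ := [Choice of free_group by <:].

Lemma fg_reduced (u : free_group) : reduced u.
Proof. by case: u. Qed.

Definition fg_one : free_group := @FreeGroup [::] isT.

Definition fg_mul (u v : free_group) : free_group :=
  FreeGroup (push_word_reduced u (fg_reduced v)).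

Definition fg_inv (u : free_group) : free_group :=
  FreeGroup (push_word_reduced (inv_word u) (isT : reduced [::])).

Lemma fg_mulA : associative fg_mul.
Proof. by move=> u v w; apply/val_inj/push_wordA/fg_reduced. Qed.

Lemma fg_mul1 : left_id fg_one fg_mul.
Proof. by move=> u; exact: val_inj. Qed.

Lemma fg_mulr1 : right_id fg_one fg_mul.
Proof. by move=> u; apply/val_inj/push_word_nil/fg_reduced. Qed.

Lemma fg_mulrV : right_inverse fg_one fg_inv fg_mul.
Proof. by move=> u; apply/val_inj; rewrite /= push_word_inv. Qed.

Lemma fg_mulVr : left_inverse fg_one fg_inv fg_mul.
Proof.
move=> u; apply/val_inj; rewrite /= -push_wordA ?fg_reduced //=.
have := @push_word_inv (inv_word u) [::] isT.
by rewrite inv_wordK (push_word_nil (fg_reduced u)).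
Qed.

HB.instance Definition _ := isGroup.Build free_group
  fg_mulA fg_mul1 fg_mulr1 fg_mulVr fg_mulrV.

Definition fg_gen (x : X) : free_group := @FreeGroup [:: (x, false)] isT.

End FreeGroup.

Section Evaluation.
Variables (X : choiceType) (G : groupType) (a : X -> G).

Definition letter_eval (l : X * bool) : G := if l.2 then (a l.1)^-1 else a l.1.

Definition word_eval (w : word X) : G := \prod_(l <- w) letter_eval l.

Definition fg_lift (u : free_group X) : G := word_eval u.

Lemma letter_evalV l : letter_eval (opp_letter l) = (letter_eval l)^-1.
Proof. by case: l => x [] //=; rewrite /letter_eval /= invgK. Qed.

Lemma word_eval_push l w : word_eval (push l w) = letter_eval l * word_eval w.
Proof.
rewrite /word_eval; case: w => [|l' w] /=; first by rewrite big_cons big_nil.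
case: eqP => [->|_]; rewrite !big_cons // letter_evalV.
by rewrite mulgA mulgV mul1g.
Qed.

Lemma fg_liftM : {morph fg_lift : u v / u * v}.
Proof.
move=> u v; rewrite /fg_lift /=.
elim: (u : word X) => [|l w IH] /=; first by rewrite /word_eval big_nil mul1g.
by rewrite word_eval_push IH mulgA /word_eval big_cons.
Qed.

Lemma fg_lift1 : fg_lift 1 = 1.
Proof. by rewrite /fg_lift /word_eval big_nil. Qed.

HB.instance Definition _ :=
  isMultiplicative.Build (free_group X) G fg_lift fg_liftM.
HB.instance Definition _ :=
  Multiplicative_isUMagmaMorphism.Build (free_group X) G fg_lift fg_lift1.

Lemma fg_lift_gen x : fg_lift (fg_gen x) = a x.
Proof. by rewrite /fg_lift /word_eval big_seq1. Qed.

End Evaluation.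

Lemma fg_lift_unique (X : choiceType) (G : groupType) (f : free_group X -> G) :
  {morph f : u v / u * v} -> f =1 fg_lift (fun x => f (fg_gen x)).
Proof.
move=> fM [w rw]; have f1 : f 1 = 1 by apply: (@mulgI _ (f 1)); rewrite -fM !mulg1.
have fV u : f u^-1 = (f u)^-1 by apply: (@mulgI _ (f u)); rewrite -fM !mulgV.
elim: w rw => [|[x b] w IH] rw.
  by rewrite (_ : FreeGroup rw = 1) ?fg_lift1 //; exact: val_inj.
pose l := if b then (fg_gen x)^-1 else fg_gen x.
have rw' := reduced_behead rw.
have -> : FreeGroup rw = l * FreeGroup rw'.
  apply: val_inj; rewrite /l; case: b rw {l} => rw;
    by rewrite /= -[RHS]/(push _ w) push_cons.
rewrite fM fg_liftM IH /l; congr (_ * _).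
by case: b {rw l}; rewrite ?fV ?gmulfV /= fg_lift_gen.
Qed.

Lemma fg_lift_comp (X : choiceType) (G H : groupType) (f : G -> H) (a : X -> G) :
  {morph f : x y / x * y} -> f \o fg_lift a =1 fg_lift (f \o a).
Proof.
move=> fM u; have gM : {morph f \o fg_lift a : u v / u * v}.
  by move=> x y /=; rewrite fg_liftM fM.
rewrite (fg_lift_unique gM); congr (fg_lift _ u).
by apply: funext => x /=; rewrite fg_lift_gen.
Qed.

Definition generates (X : choiceType) (G : groupType) (a : X -> G) : Prop :=
  forall g : G, exists u : free_group X, fg_lift a u = g.

Definition finitely_generated (G : groupType) : Prop :=
  exists n (a : 'I_n -> G), generates a.

Definition isomorphic (G H : groupType) : Prop :=
  exists2 f : G -> H, {morph f : x y / x * y} & bijective f.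

Section MarkedGroups.

(* Subsets of the free group are encoded by their indicator functions, so that
   the type of subsets carries the product topology of 2^(F_n). *)
Definition normal_subgroup (F : groupType) : set {ptws F -> bool} :=
  [set N | [/\ N 1, forall u v, N u -> N v -> N (u / v)
             & forall u v, N u -> N (u ^ v)]].

(* The space of n-generated marked groups: (G, (a_1, ..., a_n)) is represented by
   the kernel of the epimorphism x_i |-> a_i, and set_type provides the subspace
   topology. *)
Definition marked (n : nat) : Type :=
  set_type (@normal_subgroup (free_group 'I_n)).

HB.instance Definition _ n := Topological.on (marked n).

Lemma preim_normal (F K : groupType) (f : F -> K) (N : {ptws K -> bool}) :
  {morph f : u v / u * v} ->
  normal_subgroup N -> normal_subgroup ((fun u => N (f u)) : {ptws F -> bool}).
Proof.
move=> fM [N1 NB NJ].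
have f1 : f 1 = 1 by apply: (@mulgI _ (f 1)); rewrite -fM !mulg1.
have fV u : f u^-1 = (f u)^-1.
  by apply: (@mulgI _ (f u)); rewrite -fM !mulgV.
split=> [|u v|u v]; first by rewrite f1.
- by rewrite fM fV; exact: NB.
- by rewrite /conjg !fM fV; exact: NJ.
Qed.

Lemma one_normal (K : groupType) :
  normal_subgroup ((fun u => u == 1) : {ptws K -> bool}).
Proof.
split=> [|u v /eqP-> /eqP->|u v /eqP->]; first exact: eqxx.
- by rewrite mulgV.
- by rewrite conj1g.
Qed.

(* The point of the space of marked groups given by (G, a), meaningful when a
   generates G. *)
Definition marked_group (G : groupType) n (a : 'I_n -> G) : marked n :=
  SigSub (mem_set (preim_normal (fg_liftM a) (one_normal G))).

(* x_i |-> x_i for i < n and x_i |-> 1 for i >= n, from F_m to F_n. *)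
Definition pad_gen n m (i : 'I_m) : free_group 'I_n :=
  if insub (val i) is Some j then fg_gen j else 1.

(* For n <= m, this is (G, (a_1, ..., a_n)) |-> (G, (a_1, ..., a_n, 1, ..., 1)),
   the composite of the m - n successive embeddings. *)
Definition embed n m (N : marked n) : marked m :=
  SigSub (mem_set (preim_normal (fg_liftM (@pad_gen n m)) (set_valP N))).

(* Identification of the points of the spaces of n-generated marked groups, for
   all n, in their union. *)
Definition marked_eq (s t : {n & marked n}) : bool :=
  `[< exists k, [/\ (tag s <= k)%N, (tag t <= k)%N
        & embed k (tagged s) = embed k (tagged t)] >].

Lemma marked_ext n (M N : marked n) : set_val M = set_val N -> M = N.
Proof. exact: val_inj. Qed.

Lemma embed_marked_group (G : groupType) n m (a : 'I_n -> G) :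
  embed m (marked_group a) =
  marked_group (fun i : 'I_m => if insub (val i) is Some j then a j else 1).
Proof.
apply/marked_ext/funext => u /=; congr (_ == 1).
rewrite -/((fg_lift a \o fg_lift (@pad_gen n m)) u) fg_lift_comp.
  congr (fg_lift _ u); apply: funext => i /=.
  by rewrite /pad_gen; case: (insub _) => [j|]; [exact: fg_lift_gen|exact: fg_lift1].
exact: fg_liftM.
Qed.

Lemma embed_trans n k m (N : marked n) : (n <= k)%N -> embed m (embed k N) = embed m N.
Proof.
move=> nk; apply/marked_ext/funext => u /=; congr (\val N _).
rewrite -/((fg_lift (@pad_gen n k) \o fg_lift (@pad_gen k m)) u) fg_lift_comp.
  congr (fg_lift _ u); apply: funext => i /=.
  rewrite [pad_gen k i]/pad_gen; case: (@insubP _ _ 'I_k (val i)) => [j _ ji|].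
    by apply: etrans (fg_lift_gen _ _) _; rewrite /pad_gen -[val i]ji.
  rewrite -leqNgt => ki; rewrite fg_lift1 /pad_gen insubF //.
  by apply/negbTE; rewrite -leqNgt (leq_trans nk).
exact: fg_liftM.
Qed.

Lemma marked_eq_equiv : equiv_class_of marked_eq.
Proof.
split.
- by move=> s; apply/asboolP; exists (tag s).
- by move=> s t; apply/asboolP/asboolP => -[k [? ? e]]; exists k; split.
- move=> t s r /asboolP[k [sk tk e]] /asboolP[l [tl rl e']]; apply/asboolP.
  exists (maxn k l); rewrite !leq_max sk rl orbT; split=> //.
  rewrite -(embed_trans (maxn k l) _ sk) e (embed_trans _ _ tk).
  by rewrite -(embed_trans (maxn k l) _ rl) -e' (embed_trans _ _ tl).
Qed.

Canonical marked_equiv := EquivRelPack marked_eq_equiv.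

(* The final topology with respect to all the maps marked_in below; see
   open_marked_spaceP. *)
Definition marked_space : Type := quotient_topology {eq_quot marked_eq}%qT.

HB.instance Definition _ := Topological.on marked_space.

Definition marked_in n (N : marked n) : marked_space :=
  (\pi_marked_space (existT marked n N))%qT.

Lemma marked_in_embed n m (N : marked n) :
  (n <= m)%N -> marked_in (embed m N) = marked_in N.
Proof.
move=> nm; apply/eqmodP/asboolP; exists m; split=> //=.
by rewrite embed_trans.
Qed.

Lemma marked_in_inj n : injective (@marked_in n).
Proof.
move=> M N /eqmodP/asboolP[k [/= nk _ e]]; apply/marked_ext/funext => u.
pose v := fg_lift (fun i => fg_gen (widen_ord nk i)) u.
have vK : fg_lift (@pad_gen n k) v = u.
  rewrite /v -/((fg_lift (@pad_gen n k) \o fg_lift _) u) fg_lift_comp; last first.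
    exact: fg_liftM.
  rewrite [RHS](fg_lift_unique (f := id)) //; congr (fg_lift _ u).
  apply: funext => i /=; apply: etrans (fg_lift_gen _ _) _.
  by rewrite /pad_gen /= valK.
by have := congr1 (fun P : marked k => \val P v) e; rewrite /= vK.
Qed.

Lemma open_marked_spaceP (U : set marked_space) :
  open U <-> forall n, open (@marked_in n @^-1` U).
Proof. exact: sigT_openP. Qed.

End MarkedGroups.

Lemma marked_groupP (G H : groupType) n (a : 'I_n -> G) (b : 'I_n -> H) :
  generates a -> generates b ->
  marked_group a = marked_group b <->
  exists f : G -> H,
    [/\ {morph f : x y / x * y}, bijective f & forall i, f (a i) = b i].
Proof.
move=> ga gb; split=> [e|[f [fM [f' fK _] fab]]]; last first.
  apply/marked_ext/funext => u.
  change ((fg_lift a u == 1) = (fg_lift b u == 1)).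
  have <- : f \o a = b by apply: funext => i; rewrite /= fab.
  rewrite -fg_lift_comp //= -(inj_eq (can_inj fK)); congr (_ == _).
  by apply: (@mulgI _ (f 1)); rewrite -fM !mulg1.
have kerE u : (fg_lift a u == 1) = (fg_lift b u == 1).
  by have := congr1 (fun N : marked n => \val N u) e.
have eqE u v : (fg_lift a u == fg_lift a v) = (fg_lift b u == fg_lift b v).
  by rewrite -!(divg_eq1 (fg_lift _ u)) -!gmulfV -!gmulfM; exact: kerE.
pose s g := sval (cid (ga g)); pose t h := sval (cid (gb h)).
have sK g : fg_lift a (s g) = g := svalP (cid (ga g)).
have tK h : fg_lift b (t h) = h := svalP (cid (gb h)).
exists (fun g => fg_lift b (s g)); split.
- by move=> x y; apply/eqP; rewrite -fg_liftM -eqE fg_liftM !sK.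
- exists (fun h => fg_lift a (t h)) => x; apply/eqP.
    by rewrite -[X in _ == X]sK eqE tK.
  by rewrite -[X in _ == X]tK -eqE sK.
- by move=> i; apply/eqP; rewrite -(fg_lift_gen b) -eqE sK fg_lift_gen.
Qed.

Definition iso_class (G : groupType) : set marked_space :=
  [set x | exists (H : groupType) n (b : 'I_n -> H),
     [/\ generates b, isomorphic H G & x = marked_in (marked_group b)]].

Definition condensed (G : groupType) : Prop := isolated (iso_class G) = set0.

Section QuasiIsometry.
Local Open Scope ring_scope.
Variable R : realType.

(* The infimum is attained when a generates G. *)
Definition word_length (X : choiceType) (G : groupType) (a : X -> G) (g : G) : R :=
  inf [set (size w)%:R | w in [set w : word X | word_eval a w = g]].

Definition word_metric (X : choiceType) (G : groupType) (a : X -> G) (g h : G) : R :=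
  word_length a (g^-1 * h)%g.

Definition quasi_isometric_metrics (S T : Type) (dS : S -> S -> R)
    (dT : T -> T -> R) : Prop :=
  exists (f : S -> T) (lam c : R), [/\ 1 <= lam, 0 <= c,
    forall x y, lam^-1 * dS x y - c <= dT (f x) (f y) <= lam * dS x y + c
    & forall z, exists x, dT (f x) z <= c].

(* Changing the finite generating sets changes the word metrics only up to
   quasi-isometry, so the choice of a and b is immaterial. *)
Definition quasi_isometric (G H : groupType) : Prop :=
  exists n (a : 'I_n -> G) m (b : 'I_m -> H),
    [/\ generates a, generates b
      & quasi_isometric_metrics (word_metric a) (word_metric b)].

End QuasiIsometry.

(* Main.v *)
Require Import Defs.
From mathcomp Require Import all_boot all_order all_algebra.
From mathcomp Require Import all_classical all_reals topology.
From HB Require Import structures.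
From mathcomp Require Import fingroup perm zify.

Set Implicit Arguments.
Unset Strict Implicit.
Unset Printing Implicit Defensive.

Import Order.TTheory GRing.Theory Num.Theory.

Local Open Scope classical_set_scope.
Local Open Scope group_scope.

(** The two groups are wreath products with the integers: G = S_4 wr Z and
    H = C_24 wr Z, where C_24 is cyclic of order 24. An element of A wr Z is a
    pair (f, k) of a finitely supported configuration f : Z -> A of lamps and a
    position k of the lamplighter; the group is generated by the lamps a : A at
    position 0 and by the step t = (1, 1).

    _Quasi-isometry._ With respect to these generators, a path in the Cayley
    graph of A wr Z either moves the lamplighter or replaces the lamp at the
    current position by an arbitrary element of A. That description only
    involves the set A and its element 1, so a bijection A -> B that fixes 1,
    applied to all lamps, is an isometry A wr Z -> B wr Z ([relabel_isometry]).
    Here S_4 and C_24 both have 24 elements.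

    _G is condensed._ S_4 has an endomorphism phi with phi o phi = 1 and
    noncentral image: odd permutations go to (0 1)(2 3), an even permutation,
    and even ones go to 1. Let f_k multiply a configuration by its image under
    phi, translated by k + 1. As k grows, the translated copy becomes disjoint
    from any given configuration, so f_k (g h) = f_k g * f_k h for all large k:
    f_k is an asymptotic homomorphism with trivial kernel. Hence for any
    generating tuple b the tuples f_k b converge to b as markings. For large k
    they still generate: a lamp phi a is fixed by f_k because phi (phi a) = 1,
    so the smeared copy of a lamp can be divided out. Yet no automorphism
    carries b to f_k b: the image of a lamp a at 0 holds phi a at k + 1, which
    need not commute with the images of the lamps at k + 1, whereas lamps at
    distinct positions commute. So b is not isolated ([condensed_perturbation], [condensed_wreath]).

    _H is not condensed._ The subgroup M of configurations is abelian and
    contains all torsion, so a tuple that generates H and satisfies x_0^24 = 1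
    and x_i = 1 for i > 1 has x_0 = s in M, and x_1 = t must move the
    lamplighter by 1 or -1; a reflection of Z reduces to 1. Then M is a cyclic
    module over the commutative ring of Laurent polynomials in t, generated by
    s, and a word is a relation exactly when its total step is 0 and its
    Laurent polynomial kills s. By commutativity, killing the generator s is
    the same as killing M, which does not depend on the marking. So the finitely
    many conditions above define an open set that meets the class of H in a
    single point ([frame_unique], [not_condensed_wreath]). *)

(** * Generating families and points of the space of marked groups *)

Lemma fg_liftV (X : choiceType) (G : groupType) (a : X -> G) (u : free_group X) :
  fg_lift a u^-1 = (fg_lift a u)^-1.
Proof. exact: gmulfV. Qed.

Lemma word_eval_cons (X : choiceType) (G : groupType) (a : X -> G) l w :
  word_eval a (l :: w) = letter_eval a l * word_eval a w.
Proof. by rewrite /word_eval big_cons. Qed.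

Lemma word_eval_nil (X : choiceType) (G : groupType) (a : X -> G) : word_eval a [::] = 1.
Proof. by rewrite /word_eval big_nil. Qed.

(** Turns generation into an induction principle over the subgroup generated. *)
Lemma generatesP (X : choiceType) (G : groupType) (a : X -> G) :
  generates a <->
  forall P : G -> Prop, P 1 -> (forall g h, P g -> P h -> P (g * h)) ->
    (forall g, P g -> P g^-1) -> (forall x, P (a x)) -> forall g, P g.
Proof.
split=> [ga P P1 PM PV Pa g|gP g].
  have [u <-] := ga g; rewrite /fg_lift.
  elim: (u : word X) => [|[x b] w IH]; first by rewrite word_eval_nil.
  rewrite word_eval_cons; apply: PM IH; rewrite /letter_eval /=.
  by case: b; [apply: PV|]; exact: Pa.
apply: (gP (fun g => exists u : free_group X, fg_lift a u = g)) => {g}.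
- by exists 1; exact: fg_lift1.
- by move=> _ _ [u <-] [v <-]; exists (u * v); exact: fg_liftM.
- by move=> _ [u <-]; exists (u^-1); rewrite fg_liftV.
- by move=> x; exists (fg_gen x); exact: fg_lift_gen.
Qed.

Lemma generates_sub (X Y : choiceType) (G : groupType) (a : X -> G) (b : Y -> G) :
  generates a -> (forall x, exists u : free_group Y, fg_lift b u = a x) ->
  generates b.
Proof.
move=> /generatesP ga ab; apply: (ga (fun g => exists u, fg_lift b u = g)) => //.
- by exists 1; exact: fg_lift1.
- by move=> _ _ [u <-] [v <-]; exists (u * v); exact: fg_liftM.
- by move=> _ [u <-]; exists u^-1; exact: fg_liftV.
Qed.

Lemma generates_iso (X : choiceType) (G H : groupType) (f : G -> H) (a : X -> G) :
  {morph f : x y / x * y} -> bijective f -> generates a -> generates (f \o a).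
Proof.
move=> fM [f' fK f'K] ga h; have [u uE] := ga (f' h); exists u.
by rewrite -fg_lift_comp //= uE f'K.
Qed.

Lemma marked_group_iso (G H : groupType) n (f : G -> H) (a : 'I_n -> G) :
  {morph f : x y / x * y} -> bijective f -> generates a ->
  marked_group (f \o a) = marked_group a.
Proof.
move=> fM fb ga; apply/esym/marked_groupP => //; first exact: generates_iso.
by exists f.
Qed.

(** Transporting markings along isomorphisms allows one to work inside G. *)
Lemma iso_classP (G : groupType) (x : marked_space) :
  iso_class G x <->
  exists n (b : 'I_n -> G), generates b /\ x = marked_in (marked_group b).
Proof.
split=> [[H [n [b [gb [f fM fb] ->]]]]|[n [b [gb ->]]]].
  exists n, (f \o b); rewrite marked_group_iso //; split=> //.
  exact: generates_iso.
by exists G, n, b; split=> //; exists id => //; exists id.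
Qed.

Lemma marked_groupE (G : groupType) n (b : 'I_n -> G) (u : free_group 'I_n) :
  set_val (marked_group b) u = (fg_lift b u == 1).
Proof. by []. Qed.

Lemma marked_eval_near n (N : marked n) (u : free_group 'I_n) :
  \forall M \near N, set_val M u = set_val N u.
Proof.
pose sv : marked n -> {ptws (free_group 'I_n) -> bool} := set_val.
have sv_cont : {for N, continuous (proj u \o sv)}.
  apply: continuous_comp; first exact: initial_continuous.
  exact: (@proj_continuous _ (fun _ : free_group 'I_n => bool) u).
have := sv_cont [set set_val N u]; apply; exact: (@discrete_set1 bool).
Qed.

Lemma initial_cvg (S : choiceType) (T : topologicalType) (f : S -> T)
    (F : set_system S) (s : S) :
  Filter F -> f @ F --> f s -> F --> (s : initial_topology f).
Proof.
move=> FF Ffs A [_ [[C Cop <-] Cs CA]].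
have /Ffs : nbhs (f s) C by exact: open_nbhs_nbhs.
by rewrite !nbhs_filterE; apply: filterS CA.
Qed.

Lemma marked_cvg n (N : nat -> marked n) (M : marked n) :
  (forall u, \forall k \near \oo, set_val (N k) u = set_val M u) -> N @ \oo --> M.
Proof.
move=> NM; apply: initial_cvg; apply/cvg_sup => u; apply: initial_cvg.
by apply: cvg_near_cst; exact: NM.
Qed.

(** * Asymptotic homomorphisms and condensed groups *)
Lemma marked_in_continuous n : continuous (@marked_in n).
Proof.
by apply/continuousP => U Uop; exact: (open_marked_spaceP U).1 Uop n.
Qed.

(** An isolated marking would be equal to the markings that converge to it. *)
Lemma condensed_from_sequences (G : groupType) :
  (forall n (b : 'I_n -> G), generates b -> exists c : nat -> 'I_n -> G,
    [/\ \forall k \near \oo, generates (c k),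
        \forall k \near \oo, marked_group (c k) <> marked_group b
      & (fun k => marked_group (c k)) @ \oo --> marked_group b]) ->
  condensed G.
Proof.
move=> approx; rewrite /condensed -subset0 => x [/set_mem/iso_classP[n [b [gb ->]]]].
move=> [V bV VG]; have [c [gc cb cvgc]] := approx n b gb.
have cV : \forall k \near \oo, V (marked_in (marked_group (c k))).
  exact: (cvg_comp _ _ cvgc (@marked_in_continuous n _)) V bV.
have [k [gk [nk Vk]]] := filter_ex (filterI gc (filterI cb cV)).
apply: nk; apply: marked_in_inj.
rewrite -[_ = _]/([set marked_in (marked_group b)] _) -VG; split=> //.
by apply/iso_classP; exists n, (c k).
Qed.

(** Maps f k that are eventually multiplicative on each pair of elements move
    every marking of G to nearby tuples. *)
Section Perturbation.
Variables (G : groupType) (f : nat -> G -> G).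
Hypothesis fM : forall g h, \forall k \near \oo, f k (g * h) = f k g * f k h.

Lemma perturb1 : \forall k \near \oo, f k 1 = 1.
Proof.
apply: filterS (fM 1 1) => k; rewrite mulg1 => e.
by apply: (@mulgI _ (f k 1)); rewrite mulg1.
Qed.

Lemma perturbV g : \forall k \near \oo, f k g^-1 = (f k g)^-1.
Proof.
apply: filterS2 perturb1 (fM g^-1 g) => k f1; rewrite mulVg f1 => /esym e.
by apply/esym/mulg1_eq; apply: (@mulgI _ (f k g^-1)); rewrite mulgA e mul1g mulg1.
Qed.

Lemma perturb_lift (X : choiceType) (b : X -> G) (u : free_group X) :
  \forall k \near \oo, fg_lift (f k \o b) u = f k (fg_lift b u).
Proof.
rewrite /fg_lift; elim: (u : word X) => [|[x s] w IH].
  by apply: filterS perturb1 => k e; rewrite !word_eval_nil.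
rewrite word_eval_cons; apply: filterS3 IH (fM (letter_eval b (x, s)) (word_eval b w))
  (perturbV (b x)) => k.
rewrite word_eval_cons => -> -> ; rewrite /letter_eval /=.
by case: s => //= ->.
Qed.

Hypothesis f_triv : forall k g, f k g = 1 -> g = 1.

Lemma perturb_cvg n (b : 'I_n -> G) :
  (fun k => marked_group (f k \o b)) @ \oo --> marked_group b.
Proof.
apply: marked_cvg => u.
apply: filterS2 perturb1 (perturb_lift b u) => k f1 fu.
rewrite !marked_groupE fu; apply/eqP/eqP => [/f_triv//|->//].
Qed.

(** It suffices to test one marking a: the entries of a are words in those of
    any other marking b, and f k eventually respects these finitely many words,
    so that both generation and inequivalence pass from a to b. *)
Lemma condensed_perturbation m (a : 'I_m -> G) :
  generates a -> (forall k, generates (f k \o a)) ->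
  (forall k, marked_group (f k \o a) <> marked_group a) -> condensed G.
Proof.
move=> ga gfa nfa; apply: condensed_from_sequences => n b gb.
exists (fun k => f k \o b).
have /choice [v va] : forall j, exists u : free_group 'I_n, fg_lift b u = a j.
  by move=> j; exact: gb.
have near_fa : \forall k \near \oo, forall j, fg_lift (f k \o b) (v j) = f k (a j).
  by apply: filter_forall => j; rewrite -va; exact: perturb_lift.
have near_gen : \forall k \near \oo, generates (f k \o b).
  apply: filterS near_fa => k fa.
  by apply: generates_sub (gfa k) _ => j; exists (v j).
split=> //; last exact: perturb_cvg.
apply: filterS2 near_fa near_gen => k fa gfb.
case/marked_groupP => // h [hM hb hfb]; apply: (nfa k).
rewrite -(marked_group_iso hM hb (gfa k)); congr marked_group.
apply: funext => j /=; rewrite -fa -va -[LHS]/((h \o fg_lift (f k \o b)) (v j)).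
rewrite fg_lift_comp //; congr (fg_lift _ _); apply: funext => i; exact: hfb.
Qed.

End Perturbation.

(** * Wreath products with the integers *)
Definition finite_support (A : groupType) (f : int -> A) : Prop :=
  exists n : nat, forall i, (n < `|i|)%N -> f i = 1.

Section Lamps.
Variable A : groupType.

Record lamps := Lamps { lamp_at :> int -> A; _ : `[< finite_support lamp_at >] }.

HB.instance Definition _ := [isSub for lamp_at].
HB.instance Definition _ := [Choice of lamps by <:].

Lemma lampsP (f g : lamps) : (forall i, f i = g i) -> f = g.
Proof. by move=> fg; apply/val_inj/funext. Qed.

Lemma lamps_support (f : lamps) : finite_support f.
Proof. by apply/asboolP; case: f. Qed.

Fact lamps_mul_subproof (f g : lamps) : `[< finite_support (fun i => f i * g i) >].
Proof.
apply/asboolP; have [m fm] := lamps_support f; have [n gn] := lamps_support g.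
by exists (maxn m n) => i; rewrite gtn_max => /andP[mi ni]; rewrite fm ?gn ?mulg1.
Qed.

Fact lamps_inv_subproof (f : lamps) : `[< finite_support (fun i => (f i)^-1) >].
Proof.
by apply/asboolP; have [n fn] := lamps_support f; exists n => i /fn->; rewrite invg1.
Qed.

Fact lamps_one_subproof : `[< finite_support (fun _ => 1 : A) >].
Proof. by apply/asboolP; exists 0. Qed.

Fact shift_subproof (k : int) (f : lamps) : `[< finite_support (fun i => f (i - k)%R) >].
Proof.
apply/asboolP; have [n fn] := lamps_support f; exists (n + `|k|)%N => i ni.
by apply: fn; lia.
Qed.

Fact lamp_subproof (a : A) : `[< finite_support (fun i => if i == 0%R then a else 1) >].
Proof. by apply/asboolP; exists 0 => i; case: eqP => [->|]. Qed.

Definition lamps_mul (f g : lamps) : lamps := Lamps (lamps_mul_subproof f g).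
Definition lamps_inv (f : lamps) : lamps := Lamps (lamps_inv_subproof f).
Definition lamps_one : lamps := Lamps lamps_one_subproof.

Fact lamps_mulA : associative lamps_mul.
Proof. by move=> f g h; apply: lampsP => i /=; rewrite mulgA. Qed.

Fact lamps_mul1 : left_id lamps_one lamps_mul.
Proof. by move=> f; apply: lampsP => i /=; rewrite mul1g. Qed.

Fact lamps_mulr1 : right_id lamps_one lamps_mul.
Proof. by move=> f; apply: lampsP => i /=; rewrite mulg1. Qed.

Fact lamps_mulV : left_inverse lamps_one lamps_inv lamps_mul.
Proof. by move=> f; apply: lampsP => i /=; rewrite mulVg. Qed.

Fact lamps_mulrV : right_inverse lamps_one lamps_inv lamps_mul.
Proof. by move=> f; apply: lampsP => i /=; rewrite mulgV. Qed.

HB.instance Definition _ := isGroup.Build lamps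
  lamps_mulA lamps_mul1 lamps_mulr1 lamps_mulV lamps_mulrV.

Definition shift (k : int) (f : lamps) : lamps := Lamps (shift_subproof k f).

Definition lamp (a : A) : lamps := Lamps (lamp_subproof a).

Lemma shiftM k : {morph shift k : f g / f * g}.
Proof. by move=> f g; apply: lampsP. Qed.

Lemma shift1 k : shift k 1 = 1.
Proof. by apply: lampsP. Qed.

Lemma shiftV k f : shift k f^-1 = (shift k f)^-1.
Proof. by apply: lampsP. Qed.

Lemma shift0 f : shift 0 f = f.
Proof. by apply: lampsP => i /=; rewrite subr0. Qed.

Lemma shift_shift k l f : shift k (shift l f) = shift (k + l)%R f.
Proof. by apply: lampsP => i /=; rewrite opprD addrA. Qed.

Lemma lampM : {morph lamp : a b / a * b}.
Proof. by move=> a b; apply: lampsP => i /=; case: eqP => //; rewrite mulg1. Qed.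

Lemma lampV a : lamp a^-1 = (lamp a)^-1.
Proof. by apply: lampsP => i /=; case: eqP => //; rewrite invg1. Qed.

Lemma lamp1 : lamp 1 = 1.
Proof. by apply: lampsP => i /=; case: eqP. Qed.

(** The configuration is cleared from right to left inside an interval that
    contains its support. *)
Lemma lamps_ind (P : lamps -> Prop) :
  P 1 -> (forall f g, P f -> P g -> P (f * g)) ->
  (forall k a, P (shift k (lamp a))) -> forall f, P f.
Proof.
move=> P1 PM Pl f; have [n fn] := lamps_support f.
have : forall i : int, (i < - n%:Z)%R || (- n%:Z + (n.*2.+1)%:Z <= i)%R -> f i = 1.
  by move=> i hi; apply: fn; lia.
elim: (n.*2.+1) f {fn} => [|m IH] f fm.
  by rewrite (_ : f = 1) //; apply: lampsP => i; apply: fm; lia.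
(* k is the rightmost position where f may differ from 1. *)
pose k : int := (- n%:Z + m%:Z)%R; pose d := shift k (lamp (f k)).
rewrite -[f](mulVKg d); apply: PM; first exact: Pl.
apply: IH => i hi /=; have [->|ik] := eqVneq i k.
  by rewrite subrr eqxx mulVg.
by rewrite subr_eq0 (negPf ik) invg1 mul1g; apply: fm; move: ik hi; rewrite /k; lia.
Qed.

(** Configurations with disjoint supports commute. The shift by k + 1 is never
    zero, which matters later where a configuration and its translate must
    differ for every k. *)
Lemma shift_commute_near (f g : lamps) :
  \forall k \near \oo, commute (shift (Posz k.+1) f) g.
Proof.
have [m fm] := lamps_support f; have [n gn] := lamps_support g.
exists (m + n)%N => // k /= hk; apply: lampsP => i /=.
have [ni|ni] := ltnP n `|i|; first by rewrite gn // mulg1 mul1g.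
by rewrite fm ?mul1g ?mulg1 //; lia.
Qed.

End Lamps.

Section LampsMap.
Variables A B : groupType.

Fact lamps_map_subproof (h : A -> B) (h1 : h 1 = 1) (f : lamps A) :
  `[< finite_support (h \o f) >].
Proof.
by apply/asboolP; have [n fn] := lamps_support f; exists n => i /fn /= ->.
Qed.

Definition lamps_map (h : A -> B) (h1 : h 1 = 1) (f : lamps A) : lamps B :=
  Lamps (lamps_map_subproof h1 f).

Lemma lamps_mapM (h : A -> B) (h1 : h 1 = 1) :
  {morph h : a b / a * b} -> {morph lamps_map h1 : f g / f * g}.
Proof. by move=> hM f g; apply: lampsP => i; exact: hM. Qed.

Lemma lamps_map_shift (h : A -> B) (h1 : h 1 = 1) k f :
  lamps_map h1 (shift k f) = shift k (lamps_map h1 f).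
Proof. exact: lampsP. Qed.

Lemma lamps_map_lamp (h : A -> B) (h1 : h 1 = 1) a :
  lamps_map h1 (lamp a) = lamp (h a).
Proof. by apply: lampsP => i /=; case: eqP. Qed.

Lemma lamps_map1 (h : A -> B) (h1 : h 1 = 1) : lamps_map h1 1 = 1.
Proof. exact: lampsP. Qed.

End LampsMap.

Section Wreath.
Variable A : groupType.

(** The pair (f, k) stands for f * t ^ k, where conjugation by t translates
    configurations by 1. *)
Definition wreath : Type := (lamps A * int)%type.

HB.instance Definition _ := Choice.on wreath.

Definition wreath_one : wreath := (1, 0%R).
Definition wreath_mul (x y : wreath) : wreath := (x.1 * shift x.2 y.1, (x.2 + y.2)%R).
Definition wreath_inv (x : wreath) : wreath := (shift (- x.2) x.1^-1, (- x.2)%R).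

Fact wreath_mulA : associative wreath_mul.
Proof.
move=> [f k] [g l] [h m]; rewrite /wreath_mul /= shiftM shift_shift mulgA addrA.
by [].
Qed.

Fact wreath_mul1 : left_id wreath_one wreath_mul.
Proof. by move=> [f k]; rewrite /wreath_mul /= shift0 mul1g add0r. Qed.

Fact wreath_mulr1 : right_id wreath_one wreath_mul.
Proof. by move=> [f k]; rewrite /wreath_mul /= shift1 mulg1 addr0. Qed.

Fact wreath_mulV : left_inverse wreath_one wreath_inv wreath_mul.
Proof.
by move=> [f k]; rewrite /wreath_mul /= -shiftM mulVg shift1 addNr.
Qed.

Fact wreath_mulrV : right_inverse wreath_one wreath_inv wreath_mul.
Proof.
by move=> [f k]; rewrite /wreath_mul /= shift_shift subrr shift0 mulgV.
Qed.

HB.instance Definition _ := isGroup.Build wreath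
  wreath_mulA wreath_mul1 wreath_mulr1 wreath_mulV wreath_mulrV.

Lemma wreathM (f g : lamps A) (k l : int) :
  ((f, k) : wreath) * ((g, l) : wreath) = (f * shift k g, (k + l)%R).
Proof. by []. Qed.

Lemma wreathV (f : lamps A) (k : int) :
  ((f, k) : wreath)^-1 = (shift (- k) f^-1, (- k)%R).
Proof. by []. Qed.

Definition base (f : lamps A) : wreath := (f, 0%R).
Definition shifter (k : int) : wreath := (1, k).

Lemma baseM : {morph base : f g / f * g}.
Proof. by move=> f g; rewrite /base wreathM shift0. Qed.

Lemma baseV f : base f^-1 = (base f)^-1.
Proof. by rewrite /base wreathV oppr0 shift0. Qed.

Lemma shifterD k l : shifter (k + l)%R = shifter k * shifter l.
Proof. by rewrite /shifter wreathM shift1 mulg1. Qed.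

Lemma shifterV k : shifter (- k)%R = (shifter k)^-1.
Proof. by rewrite /shifter wreathV invg1 shift1. Qed.

Lemma shifter_base k (f : lamps A) : shifter k * base f = base (shift k f) * shifter k.
Proof. by rewrite /base /shifter !wreathM mul1g shift1 mulg1 addr0 add0r. Qed.

Lemma wreath_split (x : wreath) : x = base x.1 * shifter x.2.
Proof. by case: x => f k; rewrite /base /shifter wreathM shift1 mulg1 add0r. Qed.

Lemma base1 : base 1 = 1. Proof. by []. Qed.

Lemma wreath_posM (x y : wreath) : (x * y).2 = (x.2 + y.2)%R. Proof. by []. Qed.

Lemma wreath_posV (x : wreath) : (x^-1).2 = (- x.2)%R. Proof. by []. Qed.

End Wreath.

Section WreathGenerators.
Variable A : groupType.

Lemma shifter_ind (P : wreath A -> Prop) :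
  P 1 -> (forall g h, P g -> P h -> P (g * h)) -> (forall g, P g -> P g^-1) ->
  P (shifter A 1%R) -> forall k, P (shifter A k).
Proof.
move=> P1 PM PV Pt; elim/int_ind => [//|n IH|n IH].
  by rewrite intS shifterD; exact: PM.
by rewrite intS opprD shifterD shifterV; apply: PM => //; exact: PV.
Qed.

Lemma wreath_ind (P : wreath A -> Prop) :
  P 1 -> (forall g h, P g -> P h -> P (g * h)) -> (forall g, P g -> P g^-1) ->
  P (shifter A 1%R) -> (forall a, P (base (lamp a))) -> forall g, P g.
Proof.
move=> P1 PM PV Pt Pl.
have Pk := shifter_ind P1 PM PV Pt.
move=> x; rewrite (wreath_split x); apply: (PM) => //.
move: x.1 => f {x}; elim/lamps_ind: f => [//|f g Pf Pg|k a].
  by rewrite baseM; exact: PM.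
rewrite -[base _](mulgK (shifter A k)) -shifter_base; apply: (PM); first exact: PM.
exact: PV.
Qed.

End WreathGenerators.

Section StandardGenerators.
Variable A : finGroupType.

Definition wreath_gen (i : 'I_#|{: option A}|) : wreath A :=
  if enum_val i is Some a then base (lamp a) else shifter A 1%R.

Lemma wreath_gen_lamp a : wreath_gen (enum_rank (Some a)) = base (lamp a).
Proof. by rewrite /wreath_gen enum_rankK. Qed.

Lemma wreath_gen_stable : wreath_gen (enum_rank None) = shifter A 1%R.
Proof. by rewrite /wreath_gen enum_rankK. Qed.

Lemma wreath_gen_generates : generates wreath_gen.
Proof.
apply/generatesP => P P1 PM PV Pa; apply: wreath_ind => // [|a].
  by rewrite -wreath_gen_stable.
by rewrite -wreath_gen_lamp.
Qed.

Lemma wreath_finitely_generated : finitely_generated (wreath A).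
Proof. by exists #|{: option A}|, wreath_gen; exact: wreath_gen_generates. Qed.

End StandardGenerators.

(** * Quasi-isometry of wreath products over lamp groups of the same order *)
Section RelabelLamps.
Variables (A B : finGroupType) (h : A -> B) (h1 : h 1 = 1).

Definition relabel (x : wreath A) : wreath B := (lamps_map h1 x.1, x.2).

(** One step of the Cayley graph is mapped to one step: switching the current
    lamp from f k to f k * a becomes switching it from h (f k) to
    h (f k * a), by a generator that depends on x. *)
Lemma relabel_step (x : wreath A) l :
  exists l', relabel (x * letter_eval (@wreath_gen A) l)
           = relabel x * letter_eval (@wreath_gen B) l'.
Proof.
case: l => i s; rewrite /letter_eval /=.
have lampE (a : A) : exists l', relabel (x * base (lamp a))
           = relabel x * letter_eval (@wreath_gen B) l'.
  exists (enum_rank (Some ((h (x.1 x.2))^-1 * h (x.1 x.2 * a))), false).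
  rewrite /letter_eval /= wreath_gen_lamp; case: x => f k.
  rewrite /relabel /base !wreathM /= !addr0.
  congr (_, _); apply: lampsP => j /=; rewrite subr_eq0.
  by case: eqP => [->|_]; rewrite ?mulg1 // mulVKg.
rewrite {1 2}/wreath_gen; case: (enum_val i) => [a|].
  by case: s; rewrite -?baseV -?lampV; exact: lampE.
exists (enum_rank None, s); rewrite /letter_eval /= wreath_gen_stable.
by case: s; case: x {lampE} => f k; rewrite -?shifterV /relabel /shifter;
  rewrite !wreathM /= !shift1 !mulg1.
Qed.

Lemma relabel_word (x : wreath A) w :
  exists2 w', size w' = size w &
    relabel (x * word_eval (@wreath_gen A) w)
    = relabel x * word_eval (@wreath_gen B) w'.
Proof.
elim: w x => [|l w IH] x; first by exists [::]; rewrite ?word_eval_nil ?mulg1.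
have [l' ll'] := relabel_step x l.
have [w' sw ww'] := IH (x * letter_eval (@wreath_gen A) l).
exists (l' :: w'); first by rewrite /= sw.
by rewrite !word_eval_cons !mulgA ww' ll'.
Qed.

End RelabelLamps.

Section QuasiIsometry.
Variables (R : realType) (A B : finGroupType).

Lemma word_metric_refl (X : choiceType) (G : groupType) (a : X -> G) (g : G) :
  word_metric R a g g = 0%R.
Proof.
rewrite /word_metric mulVg /word_length; set S := [set _ | _ in _].
have S0 : S 0%R by exists [::] => //; rewrite /= word_eval_nil.
have Slb : lbound S 0%R by move=> _ [w _ <-]; exact: ler0n.
apply/eqP; rewrite eq_le; apply/andP; split.
  by apply: ge_inf => //; exists 0%R.
by apply: lb_le_inf => //; exists 0%R.
Qed.

Lemma relabel_isometry (h : A -> B) (k : B -> A) (h1 : h 1 = 1) (k1 : k 1 = 1) :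
  cancel h k -> forall x y : wreath A,
  word_metric R (@wreath_gen B) (relabel h1 x) (relabel h1 y)
  = word_metric R (@wreath_gen A) x y.
Proof.
move=> hK x y; rewrite /word_metric /word_length; congr inf.
have relabelK : cancel (relabel h1) (relabel k1).
  move=> [f i]; congr (_, _); apply: lampsP => j /=; exact: hK.
apply/seteqP; split=> _ [w /= wE <-].
  have [w' sw' /=] := relabel_word k1 (relabel h1 x) w.
  rewrite wE mulVKg !relabelK => ->.
  by exists w'; rewrite /= ?mulKg ?sw'.
have [w' sw' /=] := relabel_word h1 x w.
by rewrite wE mulVKg => ->; exists w'; rewrite /= ?mulKg ?sw'.
Qed.

(** Left translation corrects an arbitrary bijection to one that fixes 1. *)
Lemma eq_card_pointed_bij : #|A| = #|B| ->
  exists (h : A -> B) (k : B -> A),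
    [/\ h 1 = 1, k 1 = 1, cancel h k & cancel k h].
Proof.
move=> AB.
pose h0 (a : A) : B := enum_val (cast_ord AB (enum_rank a)).
pose k0 (b : B) : A := enum_val (cast_ord (esym AB) (enum_rank b)).
have hK : cancel h0 k0 by move=> a; rewrite /k0 enum_valK cast_ordK enum_rankK.
have kK : cancel k0 h0 by move=> b; rewrite /h0 enum_valK cast_ordKV enum_rankK.
exists (fun a => (h0 1)^-1 * h0 a), (fun b => k0 (h0 1 * b)).
split=> [||a|b]; first by rewrite mulVg.
- by rewrite mulg1.
- by rewrite mulVKg.
- by rewrite kK mulKg.
Qed.

Lemma wreath_quasi_isometric : #|A| = #|B| ->
  quasi_isometric R (wreath A) (wreath B).
Proof.
move=> /eq_card_pointed_bij[h [k [h1 k1 hK kK]]].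
exists _, (@wreath_gen A), _, (@wreath_gen B).
split; try exact: wreath_gen_generates.
exists (relabel h1), 1%R, 0%R; split=> // [x y|z].
  by rewrite (relabel_isometry h1 k1 hK) invr1 mul1r subr0 addr0 lexx.
exists (relabel k1 z); rewrite (_ : relabel h1 _ = z) ?word_metric_refl //.
by case: z => g i; congr (_, _); apply: lampsP => j /=; exact: kK.
Qed.

End QuasiIsometry.

(** * Smearing lamps: a condensed wreath product *)
Section CondensedWreath.
Variables (A : finGroupType) (phi : A -> A) (a0 b0 : A).
Hypotheses (phiM : {morph phi : a b / a * b}) (phi_phi : forall a, phi (phi a) = 1).
Hypothesis phi_noncentral : ~ commute (phi a0) b0.

Let phi1 : phi 1 = 1.
Proof. by apply: (@mulgI _ (phi 1)); rewrite -phiM !mulg1. Qed.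

(** A substitute for an automorphism: it is multiplicative on elements whose
    supports and positions are small compared with k. *)
Definition smear (k : nat) (x : wreath A) : wreath A :=
  (x.1 * shift (Posz k.+1) (lamps_map phi1 x.1), x.2).

Lemma smearM x y : \forall k \near \oo, smear k (x * y) = smear k x * smear k y.
Proof.
case: x y => f i [g j].
apply: filterS (shift_commute_near (lamps_map phi1 f) (shift i g)) => k comm_fg.
rewrite /smear wreathM /= wreathM; congr (_, _).
rewrite lamps_mapM // lamps_map_shift !shiftM !mulgA; congr (_ * _).
  by rewrite -!mulgA comm_fg.
by rewrite !shift_shift addrC.
Qed.

(** Since phi kills the smeared part, applying phi to the lamps of smear k x
    gives those of x itself; if they vanish, then so does the smeared part. *)
Lemma smear_triv k x : smear k x = 1 -> x = 1.
Proof.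
case: x => f i fiE; have /= i0 := congr1 snd fiE; have /= := congr1 fst fiE.
rewrite i0; set d := shift _ _ => fd; congr (_, _).
have phi_d : lamps_map phi1 d = 1 by apply: lampsP => j; exact: phi_phi.
have phi_f : lamps_map phi1 f = 1.
  by rewrite -[LHS]mulg1 -phi_d -lamps_mapM // fd lamps_map1.
by move: fd; rewrite /d phi_f shift1 mulg1.
Qed.

Lemma smear_shifter k i : smear k (shifter A i) = shifter A i.
Proof. by rewrite /smear /= lamps_map1 shift1 mulg1. Qed.

Lemma smear_lamp k a :
  smear k (base (lamp a)) = base (lamp a * shift (Posz k.+1) (lamp (phi a))).
Proof. by rewrite /smear /= lamps_map_lamp. Qed.

(** The lamp phi a is fixed by smear k, so its translates are available to
    divide the smeared part out of the image of the lamp a. *)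
Lemma smear_generates k : generates (smear k \o @wreath_gen A).
Proof.
apply/generatesP => P P1 PM PV Pg.
have Pt : P (shifter A 1%R).
  by have := Pg (enum_rank None); rewrite /= wreath_gen_stable smear_shifter.
have Pl a : P (base (lamp a * shift (Posz k.+1) (lamp (phi a)))).
  by have := Pg (enum_rank (Some a)); rewrite /= wreath_gen_lamp smear_lamp.
apply: wreath_ind => // a.
have Pphi : P (base (lamp (phi a))).
  by have := Pl (phi a); rewrite phi_phi lamp1 shift1 mulg1.
have Ps := shifter_ind P1 PM PV Pt.
rewrite -(mulgK (shift (Posz k.+1) (lamp (phi a))) (lamp a)) baseM baseV.
apply: (PM) => //; apply: (PV); rewrite -[base _](mulgK (shifter A (Posz k.+1))).
by rewrite -shifter_base; apply: (PM); [exact: PM|exact: PV].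
Qed.

(** An automorphism that agrees with smear k on the generators would preserve
    the relation that a0 at position 0 commutes with b0 at position k + 1, but
    the smeared images hold phi a0 and b0 at that position. *)
Lemma smear_marked_group k :
  marked_group (smear k \o @wreath_gen A) <> marked_group (@wreath_gen A).
Proof.
move=> /esym/marked_groupP[].
- exact: wreath_gen_generates.
- exact: smear_generates.
move=> h [hM _ h_gen]; apply: phi_noncentral.
pose K := Posz k.+1.
have h1 : h 1 = 1 by apply: (@mulgI _ (h 1)); rewrite -hM !mulg1.
have hV x : h x^-1 = (h x)^-1 by apply: (@mulgI _ (h x)); rewrite -hM !mulgV.
have h_lamp a : h (base (lamp a)) = base (lamp a * shift K (lamp (phi a))).
  by rewrite -wreath_gen_lamp h_gen /= wreath_gen_lamp smear_lamp.
have h_shifter i : h (shifter A i) = shifter A i.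
  apply: (shifter_ind (P := fun x => h x = x)) => //.
  - by move=> x y hx hy; rewrite hM hx hy.
  - by move=> x hx; rewrite hV hx.
  by rewrite -wreath_gen_stable h_gen /= wreath_gen_stable smear_shifter.
have h_shift i f g : h (base f) = base g -> h (base (shift i f)) = base (shift i g).
  move=> fg; apply: (@mulIg _ (shifter A i)); rewrite -[X in _ * X = _]h_shifter -hM.
  by rewrite -shifter_base hM fg h_shifter shifter_base.
have base_inj : injective (@base A) by move=> f g /(congr1 fst).
have comm_lamps : commute (lamp a0) (shift K (lamp b0)).
  apply: lampsP => i /=; rewrite subr_eq0.
  by case: eqP => [->|_]; rewrite ?mul1g ?mulg1 //; case: eqP; rewrite ?mul1g ?mulg1.
(* Both images are compared at position K. *)
have := congr1 (h \o @base A) comm_lamps.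
rewrite /= !baseM !hM (h_shift _ _ _ (h_lamp b0)) h_lamp -!baseM => /base_inj.
by move/(congr1 (fun f : lamps A => f K)); rewrite /= !subrr !sub0r /= !mul1g !mulg1.
Qed.

Lemma condensed_wreath : condensed (wreath A).
Proof.
apply: (condensed_perturbation smearM smear_triv (@wreath_gen_generates A)).
- exact: smear_generates.
- exact: smear_marked_group.
Qed.

End CondensedWreath.

Section CondensedSym.
Let o0 : 'I_4 := @Ordinal 4 0 isT.
Let o1 : 'I_4 := @Ordinal 4 1 isT.
Let o2 : 'I_4 := @Ordinal 4 2 isT.
Let o3 : 'I_4 := @Ordinal 4 3 isT.

Let dbl : 'S_4 := tperm o0 o1 * tperm o2 o3.

Let dblK : dbl * dbl = 1.
Proof.
apply/permP => i; rewrite /dbl !permM !permE /=.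
by apply/eqP; case: i => [[|[|[|[|//]]]] ?].
Qed.

Let dblN : ~ commute dbl (tperm o1 o2).
Proof. by move=> /permP/(_ o0); rewrite /dbl !permM !permE /= => /eqP. Qed.

Definition sign_twist (s : 'S_4) : 'S_4 := dbl ^+ odd_perm s.

Lemma sign_twistM : {morph sign_twist : s t / s * t}.
Proof.
move=> s t; rewrite /sign_twist odd_permM.
by case: (odd_perm s) (odd_perm t) => [] []; rewrite /= ?mulg1 ?mul1g ?dblK.
Qed.

Lemma condensed_wreath_sym : condensed (wreath 'S_4).
Proof.
apply: (@condensed_wreath _ sign_twist (tperm o0 o1) (tperm o1 o2)).
- exact: sign_twistM.
- move=> s; rewrite /sign_twist; case: (odd_perm s); rewrite /= ?odd_perm1 //.
  by rewrite odd_permM !odd_tperm.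
- by rewrite /sign_twist odd_tperm; exact: dblN.
Qed.

End CondensedSym.

(** * Markings of wreath products with cyclic lamp groups *)
Section Reflection.
Variable A : groupType.

Fact reverse_subproof (f : lamps A) : `[< finite_support (fun i => f (- i)%R) >].
Proof.
apply/asboolP; have [n fn] := lamps_support f; exists n => i ni.
by apply: fn; lia.
Qed.

Definition reverse (f : lamps A) : lamps A := Lamps (reverse_subproof f).

Definition reflect_wreath (x : wreath A) : wreath A := (reverse x.1, (- x.2)%R).

Lemma reflect_wreathM : {morph reflect_wreath : x y / x * y}.
Proof.
move=> [f k] [g l]; rewrite /reflect_wreath !wreathM /= opprD; congr (_, _).
by apply: lampsP => i /=; rewrite !opprK opprD.
Qed.

Lemma reflect_wreathK : involutive reflect_wreath.
Proof.
move=> [f k]; rewrite /reflect_wreath /= opprK; congr (_, _).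
by apply: lampsP => i /=; rewrite opprK.
Qed.

End Reflection.

Section Frames.
Variable B : groupType.
Hypothesis Bcomm : forall a b : B, commute a b.
Variable m : nat.
Implicit Types (f g s : lamps B) (t : wreath B) (w v : word 'I_m).

(** Entries of index at least 2 are trivial, because a marking by two elements
    appears in the larger spaces of marked groups with trivial entries added. *)
Definition frame s t (i : 'I_m) : wreath B :=
  if val i == 0 then base s else if val i == 1%N then t else 1.

(** The configuration part of the word w at f, that is, the action on f of the
    Fox derivative of w with respect to the first generator, a Laurent
    polynomial in the second one. *)
Fixpoint laurent w f : lamps B :=
  if w is (i, inv) :: w' then
    if val i == 0 then (if inv then f^-1 else f) * laurent w' f
    else if val i == 1%N then shift (if inv then - 1 else 1)%R (laurent w' f)
    else laurent w' f
  else 1.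

Lemma lamps_comm f g : f * g = g * f.
Proof. by apply: lampsP => i; exact: Bcomm. Qed.

Lemma lamps_mulACA f g h k : f * g * (h * k) = f * h * (g * k).
Proof. by rewrite !mulgA -(mulgA f g h) (lamps_comm g h) !mulgA. Qed.

Lemma laurentM w : {morph laurent w : f g / f * g}.
Proof.
move=> f g; elim: w => [|[i b] w IH] /=; first by rewrite mulg1.
case: eqP => _; last by case: eqP => _; rewrite IH ?shiftM.
rewrite IH -lamps_mulACA; case: b => //.
by rewrite invgM (lamps_comm g^-1).
Qed.

Lemma laurent1 w : laurent w 1 = 1.
Proof. by apply: (@mulgI _ (laurent w 1)); rewrite -laurentM !mulg1. Qed.

Lemma laurentV w f : laurent w f^-1 = (laurent w f)^-1.
Proof. by apply: (@mulgI _ (laurent w f)); rewrite -laurentM !mulgV laurent1. Qed.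

Lemma laurent_shift w k f : laurent w (shift k f) = shift k (laurent w f).
Proof.
elim: w => [|[i b] w IH] /=; first by rewrite shift1.
rewrite IH; case: eqP => _; first by rewrite shiftM; case: b; rewrite ?shiftV.
by case: eqP => _ //; rewrite !shift_shift addrC.
Qed.

Lemma laurent_comm w v f : laurent w (laurent v f) = laurent v (laurent w f).
Proof.
elim: w => [|[i b] w IH] /=; first by rewrite laurent1.
rewrite IH; case: eqP => _; first by rewrite laurentM; case: b; rewrite ?laurentV.
by case: eqP => _ //; rewrite laurent_shift.
Qed.

Lemma conj_shift t f : t.2 = 1%R -> t * base f = base (shift 1 f) * t.
Proof.
case: t => g k /= ->; rewrite /base !wreathM addr0 add0r shift0.
by rewrite lamps_comm.
Qed.

Lemma conjV_shift t f : t.2 = 1%R -> t^-1 * base f = base (shift (- 1) f) * t^-1.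
Proof.
move=> t1; apply: (@mulgI _ t); rewrite mulVKg mulgA conj_shift // shift_shift.
by rewrite subrr shift0 mulgK.
Qed.

(** Only the position of t matters for the action of t on configurations, as
    these commute; so the configuration part splits off for every such t. *)
Lemma eval_frame s t w : t.2 = 1%R ->
  word_eval (frame s t) w = base (laurent w s) * word_eval (frame 1 t) w.
Proof.
move=> t1; elim: w => [|[i b] w IH] /=; first by rewrite !word_eval_nil mulg1.
rewrite !word_eval_cons IH /letter_eval /frame /=; case: eqP => _.
  by case: b; rewrite base1 ?invg1 mul1g mulgA baseM ?baseV.
case: eqP => _; last by case: b; rewrite ?invg1 !mul1g.
by case: b; rewrite !mulgA; [rewrite conjV_shift|rewrite conj_shift].
Qed.

Lemma eval_frame_pos s s' t t' w : t.2 = t'.2 ->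
  (word_eval (frame s t) w).2 = (word_eval (frame s' t') w).2.
Proof.
move=> tt'; elim: w => [|[i b] w IH]; first by rewrite !word_eval_nil.
rewrite !word_eval_cons !wreath_posM IH; congr (_ + _)%R.
rewrite /letter_eval /frame /=; case: b; rewrite ?wreath_posV;
  by do 2?case: eqP => _ //; rewrite tt'.
Qed.

Lemma pos_exp t n : (t ^+ n).2 = (t.2 *+ n)%R.
Proof. by elim: n => // n IH; rewrite expgS wreath_posM IH mulrS. Qed.

(** Such a word is a power of t, and t has infinite order since it moves. *)
Lemma eval_frame1_eq1 t w : t.2 = 1%R ->
  (word_eval (frame 1 t) w).2 = 0%R -> word_eval (frame 1 t) w = 1.
Proof.
move=> t1.
have [n [->|->]] : exists n, word_eval (frame 1 t) w = t ^+ n \/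
    word_eval (frame 1 t) w = t ^- n.
- elim: w => [|[i b] w [n IH]]; first by exists 0; left; rewrite word_eval_nil.
  rewrite word_eval_cons /letter_eval /frame /=; case: eqP => _.
    by exists n; case: b; rewrite base1 ?invg1 mul1g.
  case: eqP => _; last by exists n; case: b; rewrite ?invg1 mul1g.
  case: b IH => [] [->|->].
  + case: n => [|n]; first by exists 1%N; right; rewrite mulg1.
    by exists n; left; rewrite expgS mulKg.
  + by exists n.+1; right; rewrite expgSr invgM.
  + by exists n.+1; left; rewrite expgS.
  + case: n => [|n]; first by exists 1%N; left; rewrite invg1 mulg1.
    by exists n; right; rewrite expgSr invgM mulVKg.
- by rewrite pos_exp t1 => n0; have -> : n = 0 by move: n0; lia.
- rewrite wreath_posV pos_exp t1 => n0; have -> : n = 0 by move: n0; lia.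
  exact: invg1.
Qed.

(** Writing s' as laurent v s, what kills s kills s' because the operators
    laurent w and laurent v commute. *)
Lemma frame_kernel_sub s t s' t' w :
  t.2 = 1%R -> t'.2 = 1%R -> generates (frame s t) ->
  word_eval (frame s t) w = 1 -> word_eval (frame s' t') w = 1.
Proof.
move=> t1 t1' gst; have base_inj : injective (@base B) by move=> f g /(congr1 fst).
have evalE v : (word_eval (frame s t) v).2 = 0%R ->
    word_eval (frame s t) v = base (laurent v s).
  move=> v0; rewrite eval_frame // eval_frame1_eq1 ?mulg1 //.
  by rewrite -v0; exact: eval_frame_pos.
move=> w1; have w0 : (word_eval (frame s t) w).2 = 0%R by rewrite w1.
have ws : laurent w s = 1 by apply: base_inj; rewrite -evalE // w1.
have [v vs'] := gst (base s').
have s'E : s' = laurent v s.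
  by apply: base_inj; rewrite -vs' -evalE ?[word_eval _ _]vs'.
rewrite eval_frame // s'E laurent_comm ws laurent1 mul1g eval_frame1_eq1 //.
by rewrite -w0; apply: eval_frame_pos; rewrite t1.
Qed.

Lemma frame_marked_group s t s' t' :
  t.2 = 1%R -> t'.2 = 1%R -> generates (frame s t) -> generates (frame s' t') ->
  marked_group (frame s t) = marked_group (frame s' t').
Proof.
move=> t1 t1' gst gst'; apply/marked_ext/funext => u.
by apply/eqP/eqP; exact: frame_kernel_sub.
Qed.

Lemma torsion_pos0 (x : wreath B) d : (0 < d)%N -> x ^+ d = 1 -> x.2 = 0%R.
Proof.
move=> d0 /(congr1 snd); rewrite pos_exp /= => /eqP.
by rewrite mulrn_eq0 -leqn0 leqNgt d0 => /eqP.
Qed.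

(** The position of each element of the subgroup generated by the frame is a
    multiple of that of t, and 1 has to be such a multiple. *)
Lemma frame_pos_unit s t : generates (frame s t) -> t.2 = 1%R \/ t.2 = (- 1)%R.
Proof.
move=> /generatesP gst.
have [k] : exists k : int, (shifter B 1%R).2 = (k * t.2)%R.
  apply: (gst (fun g : wreath B => exists k : int, g.2 = (k * t.2)%R)
    _ _ _ _ (shifter B 1%R)).
  - by exists 0%R; rewrite mul0r.
  - by move=> g h [k gk] [l hl]; exists (k + l)%R; rewrite wreath_posM gk hl mulrDl.
  - by move=> g [k gk]; exists (- k)%R; rewrite wreath_posV gk mulNr.
  - move=> i; rewrite /frame; case: eqP => _; first by exists 0%R; rewrite mul0r.
    case: eqP => _; first by exists 1%R; rewrite mul1r.
    by exists 0%R; rewrite mul0r.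
rewrite /= => kt; have : (`|k| * `|t.2|)%N = 1%N by rewrite -abszM -kt.
by move/eqP; rewrite muln_eq1 => /andP[_ /eqP]; lia.
Qed.

Lemma reflect_frame s t :
  @reflect_wreath B \o frame s t = frame (reverse s) (reflect_wreath t).
Proof.
apply: funext => i; rewrite /frame /=; case: eqP => _.
  by rewrite /reflect_wreath /= oppr0.
case: eqP => _ //; rewrite /reflect_wreath /= oppr0; congr (_, _); exact: lampsP.
Qed.

(** Up to the reflection of the integers, t moves by 1, where all frames that
    generate have the same relations. *)
Lemma frame_unique c s t : generates (frame (lamp c) (shifter B 1%R)) ->
  generates (frame s t) ->
  marked_group (frame s t) = marked_group (frame (lamp c) (shifter B 1%R)).
Proof.
move=> gc gst; case: (frame_pos_unit gst) => t1; first exact: frame_marked_group.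
have reflM := @reflect_wreathM B.
have reflB : bijective (@reflect_wreath B).
  by exists (@reflect_wreath B); exact: reflect_wreathK.
rewrite -(marked_group_iso reflM reflB gst) reflect_frame.
apply: frame_marked_group => //.
  by rewrite /= t1 opprK.
by rewrite -reflect_frame; exact: generates_iso.
Qed.

End Frames.

(** * An isolated marking *)
Definition padded (G : groupType) n m (b : 'I_n -> G) (i : 'I_m) : G :=
  if insub (val i) is Some j then b j else 1.

Lemma marked_in_padded (G : groupType) n m (b : 'I_n -> G) : (n <= m)%N ->
  marked_in (marked_group (padded b : 'I_m -> G)) = marked_in (marked_group b).
Proof.
by move=> nm; rewrite -(marked_in_embed (marked_group b) nm) embed_marked_group.
Qed.

Lemma padded_generates (G : groupType) n m (b : 'I_n -> G) : (n <= m)%N ->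
  generates b -> generates (padded b : 'I_m -> G).
Proof.
move=> nm gb; apply: generates_sub gb _ => i; exists (fg_gen (widen_ord nm i)).
by rewrite fg_lift_gen /padded /= valK.
Qed.

Section Isolation.
Variable d : nat.

(** One word for each index: x_0 ^ d for 0, and x_i for i > 1. No condition is
    put on x_1, hence the trivial word. *)
Definition frame_relator n (i : 'I_n) : free_group 'I_n :=
  if val i == 0 then fg_gen i ^+ d else if val i == 1%N then 1 else fg_gen i.

Definition frame_like n (N : marked n) : Prop :=
  forall i : 'I_n, set_val N (frame_relator i).

Definition frame_like_space : set marked_space :=
  [set x | exists n (N : marked n), x = marked_in N /\ frame_like N].

Lemma fg_liftX (X : choiceType) (G : groupType) (a : X -> G) u k :
  fg_lift a (u ^+ k) = fg_lift a u ^+ k.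
Proof. exact: gmulfXn. Qed.

(** The added entries are trivial, so they satisfy the conditions: these define
    a subset of the union of the spaces of marked groups. *)
Lemma frame_like_embed n m (N : marked n) : (n <= m)%N ->
  frame_like (embed m N) <-> frame_like N.
Proof.
move=> nm.
have padE (i : 'I_m) : fg_lift (@pad_gen n m) (frame_relator i) =
    if insub (val i) is Some j then frame_relator (j : 'I_n) else 1.
  have -> : fg_lift (@pad_gen n m) (frame_relator i) =
    if val i == 0 then pad_gen n i ^+ d else if val i == 1%N then 1 else pad_gen n i.
    rewrite /frame_relator; case: eqP => _; first by rewrite fg_liftX fg_lift_gen.
    by case: eqP => _; rewrite ?fg_lift1 ?fg_lift_gen.
  rewrite /pad_gen /frame_relator; case: insubP => [j _ ->//|_].
  by rewrite expg1n; do 2?case: ifP.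
have N1 : set_val N 1 by have [] := set_valP N.
split=> Nr i.
  have : set_val N (fg_lift (@pad_gen n m) (frame_relator (widen_ord nm i))) := Nr _.
  by rewrite padE /= valK.
change (is_true (set_val N (fg_lift (@pad_gen n m) (frame_relator i)))).
rewrite padE; case: (insub _) => [j|]; [exact: Nr|exact: N1].
Qed.

Lemma frame_like_spaceE n (N : marked n) :
  frame_like_space (marked_in N) <-> frame_like N.
Proof.
split=> [[m [M [/eqmodP/asboolP[k /= [nk mk e]] Mr]]]|Nr]; last by exists n, N.
by rewrite -(frame_like_embed N nk) e frame_like_embed.
Qed.

Lemma frame_like_open : open frame_like_space.
Proof.
apply/open_marked_spaceP => n.
rewrite openE => N /frame_like_spaceE Nr.
have near_eq i := marked_eval_near N (frame_relator i).
apply: filterS (filter_forall _ near_eq) => M MN.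
by apply/frame_like_spaceE => i; rewrite MN; exact: Nr.
Qed.

(** Torsion elements of the wreath product have position 0, so the first entry
    is a configuration. *)
Lemma frame_like_group (B : groupType) n (b : 'I_n -> wreath B) (n1 : (1 < n)%N) :
  (0 < d)%N -> frame_like (marked_group b) ->
  exists s, b = frame s (b (Ordinal n1)).
Proof.
move=> d0 br.
pose i0 : 'I_n := Ordinal (ltnW n1).
have b0 : b i0 ^+ d = 1.
  by have := br i0; rewrite /frame_relator /= marked_groupE fg_liftX fg_lift_gen => /eqP.
exists (b i0).1; apply: funext => i; rewrite /frame; case: eqP => [i0E|i0N].
  rewrite (_ : i = i0); last exact: val_inj.
  by rewrite {1}[b i0]surjective_pairing (torsion_pos0 d0 b0).
case: eqP => [i1E|i1N]; first by congr b; exact: val_inj.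
have := br i; rewrite /frame_relator (introF eqP i0N) (introF eqP i1N).
by rewrite marked_groupE fg_lift_gen => /eqP.
Qed.

End Isolation.

Section NotCondensed.
Variables (B : groupType) (c : B) (d : nat).
Hypotheses (d0 : (0 < d)%N) (cd : c ^+ d = 1) (cB : forall b, exists n, b = c ^+ n).

Let Bcomm (a b : B) : commute a b.
Proof.
by have [k ->] := cB a; have [l ->] := cB b; exact: commuteX2 (commute_refl c).
Qed.

Lemma frame_generates m (m1 : (1 < m)%N) :
  generates (frame (m := m) (lamp c) (shifter B 1%R)).
Proof.
apply/generatesP => P P1 PM PV Pf; apply: wreath_ind => // [|b].
  exact: (Pf (Ordinal m1)).
have Pc : P (base (lamp c)) := Pf (Ordinal (ltnW m1)).
have [n ->] := cB b; elim: n => [|n IH]; first by rewrite lamp1.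
by rewrite expgS lampM baseM; exact: PM.
Qed.

Lemma padded_frame m s (t : wreath B) :
  (padded (frame (m := 2) s t) : 'I_m -> _) = frame s t.
Proof.
apply: funext => i; rewrite /padded /frame; case: insubP => [j _ ->//|].
by case: (val i) => [|[|k]].
Qed.

Lemma not_condensed_wreath : ~ condensed (wreath B).
Proof.
rewrite /condensed -subset0 => /(_ (marked_in (marked_group
  (frame (m := 2) (lamp c) (shifter B 1%R))))); apply; split.
  by apply/mem_set/iso_classP; exists 2, (frame (lamp c) (shifter B 1%R)); split=> //;
    exact: frame_generates.
set x0 := marked_in _.
have fx0 : frame_like_space d x0.
  apply/frame_like_spaceE => i; rewrite marked_groupE /frame_relator.
  case: i => [[|[|//]] lti] /=; last by rewrite fg_lift1.
  rewrite fg_liftX fg_lift_gen /frame /=; apply/eqP.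
  have -> : base (lamp c) ^+ d = base (lamp (c ^+ d)).
    elim: d => [|n IH]; first by rewrite lamp1.
    by rewrite !expgS IH lampM baseM.
  by rewrite cd lamp1.
exists (frame_like_space d).
  by apply: open_nbhs_nbhs; split=> //; exact: frame_like_open.
apply/seteqP; split=> [x [fx /iso_classP[n [b [gb xE]]]]|_ ->]; last first.
  split=> //; apply/iso_classP; exists 2, (frame (lamp c) (shifter B 1%R)).
  by split=> //; exact: frame_generates.
have n_le : (n <= maxn n 2)%N by exact: leq_maxl.
have m1 : (1 < maxn n 2)%N by exact: leq_maxr.
have gb' : generates (padded b : 'I_(maxn n 2) -> wreath B) by exact: padded_generates.
(* A marking by fewer than two elements is padded to two. *)
move: fx; rewrite xE /= -(marked_in_padded b n_le).
move=> /frame_like_spaceE/(frame_like_group m1 d0)[s b'E].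
rewrite b'E /x0 -(marked_in_padded _ (leq_maxr n 2)) padded_frame.
congr marked_in; apply: frame_unique => //; first exact: frame_generates.
by rewrite -b'E.
Qed.

End NotCondensed.

Theorem corollary1p7 (R : realType) :
  exists G H : groupType,
    [/\ finitely_generated G, finitely_generated H, quasi_isometric R G H,
        condensed G & ~ condensed H].
Proof.
exists (wreath 'S_4), (wreath 'Z_24); split.
- exact: wreath_finitely_generated.
- exact: wreath_finitely_generated.
- by apply: wreath_quasi_isometric; rewrite card_Sn card_ord.
- exact: condensed_wreath_sym.
apply: (@not_condensed_wreath _ (1%R : 'Z_24) 24) => //.
  by apply: val_inj; vm_compute.
by move=> b; exists b; exact/esym/(@Zp1_expgz 23).
Qed.
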